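(* Let $\eta\in\Omega=\{0,1\}^{\mathbb N}$. For any $k,\ell\in\mathbb N$ and $x\in\mathbb Z_{\ge0}$, $$\Psi_k\big(\Psi_\ell(\eta)\big)(x)=\Psi_{k+\ell}(\eta)(x).$$
   Context: $\mathbb N=\{1,2,\dots\}$ and $\Omega=\{0,1\}^{\mathbb N}$, with $\eta(0)=0$ for $\eta\in\Omega$. Carrier with seat numbers: for $\eta\in\Omega$ and $k\in\mathbb N$, $\mathcal W_k(\eta,\cdot):\mathbb Z_{\ge0}\to\{0,1\}$ is defined by $\mathcal W_k(\eta,0)=0$ and, for $x\ge1$, $$\mathcal W_k(\eta,x)=\mathcal W_k(\eta,x-1)+\eta^{\uparrow}_k(x)-\eta^{\downarrow}_k(x),$$ where the seat number configuration $\eta^\sigma_k\in\Omega$, $\sigma\in\{\uparrow,\downarrow\}$, is $$\eta^{\uparrow}_k(x)=\eta(x)(1-\mathcal W_k(\eta,x-1))\prod_{j=1}^{k-1}\mathcal W_j(\eta,x-1),\qquad \eta^{\downarrow}_k(x)=(1-\eta(x))\mathcal W_k(\eta,x-1)\prod_{j=1}^{k-1}(1-\mathcal W_j(\eta,x-1)).$$ For $k\in\mathbb N$ let $\xi_k(\eta,0)=0$, $\xi_k(\eta,x)=x-\sum_{y=1}^{x}\sum_{j=1}^{k}(\eta^\uparrow_j(y)+\eta^\downarrow_j(y))$, and $s_k(\eta,i)=\min\{x\in\mathbb Z_{\ge0}:\xi_k(\eta,x)=i\}$ for $i\in\mathbb Z_{\ge0}$, where $\min\emptyset:=\infty$; in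 particular $s_k(\eta,0)=0$. The $k$-skip map $\Psi_k:\Omega\to\Omega$ is $\Psi_k(\eta)(x)=\eta(s_k(\eta,x))$. *)

(* Defs.v *)
From mathcomp Require Import all_boot all_order all_algebra.
From mathcomp Require Import boolp.

Set Implicit Arguments.
Unset Strict Implicit.
Unset Printing Implicit Defensive.

Import Order.TTheory GRing.Theory Num.Theory.
Local Open Scope ring_scope.

(* Omega = {0,1}^N with N = {1, 2, ...}, each configuration being extended    *)
(* to the site 0 by eta(0) = 0.                                               *)
Record config := Config {
  config_fun :> nat -> bool;
  config0 : config_fun 0%N = false
}.

(* One step of the carrier: [a] is the content of the site being visited and  *)
(* [w j] is the occupation of seat number j (j >= 1) before the visit.        *)
Definition board (a : bool) (w : nat -> int) (k : nat) : int :=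
  a%:R * (1 - w k) * \prod_(1 <= j < k) w j.

Definition leave (a : bool) (w : nat -> int) (k : nat) : int :=
  (1 - a%:R) * w k * \prod_(1 <= j < k) (1 - w j).

(* [carrier eta x k] is W_k(eta, x). The recursion is on the site x, all the  *)
(* seats being updated simultaneously, since W_k(eta, x) depends on           *)
(* W_j(eta, x - 1) for every j <= k. The arithmetic takes place in int so     *)
(* that no subtraction is truncated; see carrier_01 for the range.            *)
Fixpoint carrier (eta : config) (x : nat) : nat -> int :=
  if x is y.+1 then
    fun k => carrier eta y k + board (eta x) (carrier eta y) k
                             - leave (eta x) (carrier eta y) k
  else fun=> 0.

(* Only the values at sites x >= 1 are meaningful (x.-1 truncates at x = 0).  *)
Definition seat_up (k : nat) (eta : config) (x : nat) : int :=
  board (eta x) (carrier eta x.-1) k.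

Definition seat_down (k : nat) (eta : config) (x : nat) : int :=
  leave (eta x) (carrier eta x.-1) k.

Definition xi (k : nat) (eta : config) (x : nat) : int :=
  x%:Z - \sum_(1 <= y < x.+1) \sum_(1 <= j < k.+1)
           (seat_up j eta y + seat_down j eta y).

(* s_k(eta, i) in {0, 1, ...} + {oo}, where None stands for oo = min of the   *)
(* empty set.                                                                 *)
Definition skip_site (k : nat) (eta : config) (i : nat) : option nat :=
  match pselect (exists x : nat, xi k eta x == i%:Z) with
  | left ex => Some (ex_minn ex)
  | right _ => None
  end.

(* Convention eta(oo) = 0. Some value is needed for Psi_k to be defined on    *)
(* the whole of Omega: for instance s_1(eta, 1) = oo for eta = 101010...      *)
Definition config_at (eta : config) (x : option nat) : bool :=
  if x is Some y then eta y else false.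

Lemma carrier_01 (eta : config) (x k : nat) :
  carrier eta x k = 0 \/ carrier eta x k = 1.
Proof.
elim: x k => [|x IHx] k /=; first by left.
have P1 n : let p := \prod_(1 <= j < n) carrier eta x j in p = 0 \/ p = 1.
  apply: (big_ind (fun p : int => p = 0 \/ p = 1)) => [|p q [] -> [] ->|j _];
    rewrite ?(mul0r, mulr0, mulr1) //; by [left|right|].
have P2 n : let p := \prod_(1 <= j < n) (1 - carrier eta x j) in
    p = 0 \/ p = 1.
  apply: (big_ind (fun p : int => p = 0 \/ p = 1)) => [|p q [] -> [] ->|j _];
    rewrite ?(mul0r, mulr0, mulr1) //; try by [left|right].
  by case: (IHx j) => ->; [right|left].
rewrite /board /leave.
by case: (eta x.+1); case: (IHx k) => ->; case: (P1 k) => ->;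
  case: (P2 k) => ->; by [left|right].
Qed.

Lemma skip_site0 (k : nat) (eta : config) : skip_site k eta 0 = Some 0%N.
Proof.
have xi0 : xi k eta 0 == 0%:Z by rewrite /xi big_geq // subr0.
rewrite /skip_site; case: pselect => [ex|[]]; last by exists 0%N.
by case: ex_minnP => n _ /(_ _ xi0); rewrite leqn0 => /eqP ->.
Qed.

Lemma skip_subproof (k : nat) (eta : config) :
  config_at eta (skip_site k eta 0) = false.
Proof. by rewrite skip_site0 /= config0. Qed.

Definition skip (k : nat) (eta : config) : config :=
  @Config (fun x => config_at eta (skip_site k eta x)) (skip_subproof k eta).

(* Main.v *)
Require Import Defs.
From mathcomp Require Import all_boot all_order all_algebra.
From mathcomp Require Import boolp zify ring.

(* The seats above l change only at the sites counted by xi l, namely those   *)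
(* where a particle meets l full seats or a hole meets l empty seats; at such *)
(* a site the seats l+1, l+2, ... act as a fresh carrier reading the content  *)
(* of the site. Hence W_(l+j)(eta, x) = W_j(Psi_l eta, xi_l(eta, x)), so that *)
(* xi_(k+l)(eta, x) = xi_k(Psi_l eta, xi_l(eta, x)). As xi_l is nondecreasing *)
(* with steps 0 or 1, taking first hitting sites gives                        *)
(* s_(k+l)(eta, i) = s_l(eta, s_k(Psi_l eta, i)), also when it is infinite.   *)

Set Implicit Arguments.
Unset Strict Implicit.
Unset Printing Implicit Defensive.

Import Order.TTheory GRing.Theory Num.Theory.
Local Open Scope ring_scope.

(* 1 if the content [a] is handled by none of the seats 1, ..., k, else 0.    *)
Definition pass (a : bool) (w : nat -> int) (k : nat) : int :=
  \prod_(1 <= j < k.+1) (if a then w j else 1 - w j).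

(** Telescoping: the term of seat [j] is the drop from [pass a w (j-1)] to [pass a w j], for
    arbitrary integer occupations. *)
Lemma sum_board_leave a w k :
  \sum_(1 <= j < k.+1) (board a w j + leave a w j) = 1 - pass a w k.
Proof.
rewrite /pass; elim: k => [|k IHk]; first by rewrite !big_geq // subrr.
rewrite big_nat_recr //= IHk [in RHS]big_nat_recr //= /board /leave.
by case: a {IHk} => /=; ring.
Qed.

Lemma prod_seat_shift (f : nat -> int) l j : (0 < j)%N ->
  \prod_(1 <= i < l + j) f i
    = \prod_(1 <= i < l.+1) f i * \prod_(1 <= i < j) f (l + i)%N.
Proof.
move=> j0; rewrite (big_cat_nat (n := l.+1)) //=; last by lia.
rewrite -{2}[l.+1]add1n big_addn addKn; congr (_ * _).
by apply: eq_bigr => i _; rewrite addnC.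
Qed.

Lemma pass_add a w k l :
  pass a w (k + l) = pass a w l * pass a (fun j => w (l + j)%N) k.
Proof. by rewrite /pass addnC -addnS prod_seat_shift. Qed.

Lemma board_shift a w l j : (0 < j)%N ->
  board a w (l + j) = pass a w l * board a (fun i => w (l + i)%N) j.
Proof.
move=> j0; rewrite /board /pass prod_seat_shift //.
by case: a => /=; ring.
Qed.

Lemma leave_shift a w l j : (0 < j)%N ->
  leave a w (l + j) = pass a w l * leave a (fun i => w (l + i)%N) j.
Proof.
move=> j0; rewrite /leave /pass (prod_seat_shift (fun i => 1 - w i)) //.
by case: a => /=; ring.
Qed.

(** Index 0 is left out because [w (l + 0)] is the real seat [l], unrelated to index 0 of the fresh
    carrier. *)
Lemma eq_pass a v w k : (forall j, (0 < j)%N -> v j = w j) ->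
  pass a v k = pass a w k.
Proof. by move=> vw; apply: eq_big_nat => j /andP[j0 _]; rewrite vw. Qed.

Lemma eq_board a v w k : (forall j, (0 < j)%N -> v j = w j) -> (0 < k)%N ->
  board a v k = board a w k.
Proof.
move=> vw k0; rewrite /board vw //; congr (_ * _).
by apply: eq_big_nat => j /andP[j0 _]; rewrite vw.
Qed.

Lemma eq_leave a v w k : (forall j, (0 < j)%N -> v j = w j) -> (0 < k)%N ->
  leave a v k = leave a w k.
Proof.
move=> vw k0; rewrite /leave vw //; congr (_ * _).
by apply: eq_big_nat => j /andP[j0 _]; rewrite vw.
Qed.

Lemma pass_carrier_01 eta x a k :
  pass a (carrier eta x) k = (pass a (carrier eta x) k == 1)%:R.
Proof.
suff [->|->] : pass a (carrier eta x) k = 0 \/ pass a (carrier eta x) k = 1.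
- by [].
- by [].
apply: (big_ind (fun p : int => p = 0 \/ p = 1)) => [|p q [] -> [] ->|j _];
  rewrite ?(mul0r, mulr0, mulr1) //; try by [left|right].
by case: a; case: (carrier_01 eta x j) => ->; by [left|right].
Qed.

Lemma xi0 k eta : xi k eta 0 = 0.
Proof. by rewrite /xi big_geq. Qed.

Lemma xiS k eta x :
  xi k eta x.+1 = xi k eta x + pass (eta x.+1) (carrier eta x) k.
Proof.
rewrite /xi [X in _ - X]big_nat_recr //= [X in _ - (_ + X)]sum_board_leave.
by rewrite intS; ring.
Qed.

(** [xi] as a natural number, so that it can serve as a site of the skipped configuration. *)
Fixpoint xin k (eta : config) x : nat :=
  if x is y.+1 then (xin k eta y + (pass (eta x) (carrier eta y) k == 1))%N
  else 0%N.

Lemma xinE k eta x : xi k eta x = (xin k eta x)%:Z.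
Proof.
elim: x => [|x IHx]; first exact: xi0.
by rewrite xiS IHx pass_carrier_01 /= PoszD natz.
Qed.

Lemma xin_le k eta : {homo xin k eta : x y / (x <= y)%N}.
Proof.
by apply: homo_leq => // [? ? ?|x]; [exact: leq_trans|exact: leq_addr].
Qed.

Lemma xin_ivt k eta x i : (i <= xin k eta x)%N -> exists y, xin k eta y = i.
Proof.
elim: x => [|x IHx /=]; first by rewrite leqn0 => /eqP ->; exists 0%N.
have [/IHx//|lt_xi le_i] := leqP i (xin k eta x).
by exists x.+1 => /=; case: (_ == _) le_i; lia.
Qed.

Variant skip_site_spec k eta i : option nat -> Prop :=
| SkipSite y of xin k eta y = i & (forall z, xin k eta z = i -> (y <= z)%N) :
    skip_site_spec k eta i (Some y)
| NoSkipSite of (forall z, xin k eta z <> i) : skip_site_spec k eta i None.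

Lemma skip_siteP k eta i : skip_site_spec k eta i (skip_site k eta i).
Proof.
rewrite /skip_site; case: pselect => [ex|nex].
  case: ex_minnP => y; rewrite xinE => /eqP[xiy] miny; constructor => // z xiz.
  by apply: miny; rewrite xinE xiz.
by constructor => z xiz; apply: nex; exists z; rewrite xinE xiz.
Qed.

Lemma skip_site_Some k eta i y : xin k eta y = i ->
  (forall z, xin k eta z = i -> (y <= z)%N) -> skip_site k eta i = Some y.
Proof.
move=> xiy miny; case: skip_siteP => [z xiz minz|/(_ y)//].
by congr Some; apply/eqP; rewrite eqn_leq minz // miny.
Qed.

(** By monotonicity, a site where the count increases is the first to attain its new value. *)
Lemma skip_xinS l eta x : xin l eta x.+1 = (xin l eta x).+1 ->
  skip l eta (xin l eta x).+1 = eta x.+1.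
Proof.
move=> xiS; rewrite /= (@skip_site_Some _ _ _ x.+1) // => z xiz.
by rewrite ltnNge; apply/negP => /(@xin_le l eta); rewrite xiz ltnn.
Qed.

Lemma carrier_skip l eta x j : (0 < j)%N ->
  carrier eta x (l + j) = carrier (skip l eta) (xin l eta x) j.
Proof.
elim: x j => [|x IHx] j j0 //=.
rewrite board_shift // leave_shift // IHx // pass_carrier_01.
have := @skip_xinS l eta x; rewrite [xin l eta x.+1]/=.
(* If [pass] is 0, both sides stand still; if it is 1, the skipped configuration reads [eta x.+1]
   next. *)
case: eqP => _ /=; last by rewrite addn0 !mul0r addr0 subr0.
rewrite addn1 => /(_ erefl) /= ->.
by rewrite !mul1r (eq_board _ IHx) // (eq_leave _ IHx).
Qed.

(** [pass] is multiplicative: a site counts for [k + l] when it passes the first [l] seats and then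
    the next [k]. *)
Lemma xin_skip k l eta x :
  xin (k + l) eta x = xin k (skip l eta) (xin l eta x).
Proof.
elim: x => [|x IHx] //=; rewrite IHx pass_add.
rewrite (eq_pass _ _ (@carrier_skip l eta x)).
rewrite [pass _ (carrier eta x) l]pass_carrier_01.
have := @skip_xinS l eta x; rewrite [xin l eta x.+1]/=.
case: eqP => _ /=; last by rewrite mul0r !addn0.
by rewrite addn1 => /(_ erefl) /= ->; rewrite mul1r.
Qed.

Theorem proposition2p9 (eta : config) (k l x : nat) (hk : (0 < k)%N)
    (hl : (0 < l)%N) :
  skip k (skip l eta) x = skip (k + l)%N eta x.
Proof.
rewrite [LHS]/= [RHS]/=; case: (skip_siteP k) => [y xiy miny|noy] /=; last first.
  by case: skip_siteP => // z; rewrite xin_skip => /noy.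
case: (skip_siteP l) => [z xiz minz|noz] /=.
  rewrite (@skip_site_Some _ _ _ z) ?xin_skip ?xiz // => t.
  rewrite xin_skip => /miny le_y.
  (* If [t <= z], the [l]-count at [t] is squeezed to [y], whose first hit is [z]. *)
  have [//|/(@xin_le l eta) le_t] := orP (leq_total z t).
  by apply: minz; apply/eqP; rewrite eqn_leq le_y -xiz le_t.
(* A hit [t] would have [l]-count at least [y]; with steps 0 or 1, the value [y] would then be
   attained. *)
by case: skip_siteP => // t; rewrite xin_skip => /miny /xin_ivt[z /noz].
Qed.
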